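(* Let $U$ be Friedman-reflexive with interpreter-selecting function ${\sf C}$. Then $U\vdash\neg{\sf C}(\bot)$, and for all finitely axiomatised $A$, $B$ with the same signature, $U\vdash{\sf C}(A\vee B)\leftrightarrow({\sf C}(A)\vee{\sf C}(B))$.
   Context: Theories are first-order theories in finite signature; finitely axiomatised theories are identified with the conjunction of their axioms (so $A\vee B$ and $\bot$ are finitely axiomatised theories); interpretations may be multi-dimensional and piecewise; $W\rhd D$ means $W$ interprets $D$. A $U$-sentence $C$ is an interpreter of finitely axiomatised $A$ over $U$ iff for all $U$-sentences $B$: $(U+B)\rhd A$ iff $U+B\vdash C$; $U$ is Friedman-reflexive iff every finitely axiomatised $A$ has an interpreter, and ${\sf C}(A)$ denotes a chosen interpreter. *)

(* Defs.v *)
From mathcomp Require Import all_boot all_order.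

Set Implicit Arguments.
Unset Strict Implicit.
Unset Printing Implicit Defensive.

(* Individual constants are function symbols of arity 0. *)
Record signature := Signature {
  fsym : finType;
  far : fsym -> nat;
  rsym : finType;
  rar : rsym -> nat
}.

Section Syntax.
Variable S : signature.

(* [term n] and [form n] are the terms and formulas with free variables among
   n many, in well-scoped de Bruijn style: under a quantifier, [ord0] is the
   variable just bound and [lift ord0 x] is the outer variable [x]. *)
Inductive term (n : nat) : Type :=
| Var of 'I_n
| Fun (f : fsym S) of {ffun 'I_(far f) -> term n}.

Inductive form : nat -> Type :=
| Bot n : form n
| Eq n of term n & term n : form n
| Rel n (R : rsym S) of {ffun 'I_(rar R) -> term n} : form n
| And n of form n & form n : form n
| Or n of form n & form n : form n
| Imp n of form n & form n : form n
| All n of form n.+1 : form n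
| Ex n of form n.+1 : form n.

Definition Neg n (phi : form n) : form n := Imp phi (Bot n).
Definition Top n : form n := Neg (Bot n).
Definition Iff n (phi psi : form n) : form n := And (Imp phi psi) (Imp psi phi).

Definition sentence := form 0.

(* A theory is given by an arbitrary set of axioms. *)
Definition theory := sentence -> Prop.

End Syntax.

Arguments Var {S n} _.
Arguments Fun {S n} f _.
Arguments Bot {S n}.
Arguments Rel {S n} R _.
Arguments Top {S n}.

Definition scons (X : Type) n (x : X) (s : 'I_n -> X) : 'I_n.+1 -> X :=
  fun i => if unlift ord0 i is Some j then s j else x.

Definition snil (X : Type) : 'I_0 -> X :=
  fun i => let: Ordinal _ lt_i0 := i in False_rect X (notF lt_i0).
Arguments snil {X} _.

Section Substitution.
Variable S : signature.

Fixpoint subst_term n m (s : 'I_n -> term S m) (t : term S n) : term S m :=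
  match t with
  | Var x => s x
  | Fun f ts => Fun f [ffun l => subst_term s (ts l)]
  end.

Definition shift_term n : term S n -> term S n.+1 :=
  subst_term (fun x => Var (lift ord0 x)).

Definition up n m (s : 'I_n -> term S m) : 'I_n.+1 -> term S m.+1 :=
  scons (Var ord0) (fun x => shift_term (s x)).

Fixpoint subst n (phi : form S n) : forall m, ('I_n -> term S m) -> form S m :=
  match phi in form _ n return forall m, ('I_n -> term S m) -> form S m with
  | Bot _ => fun m s => Bot
  | Eq _ t u => fun m s => Eq (subst_term s t) (subst_term s u)
  | Rel _ R ts => fun m s => Rel R [ffun l => subst_term s (ts l)]
  | And _ a b => fun m s => And (subst a s) (subst b s)
  | Or _ a b => fun m s => Or (subst a s) (subst b s)
  | Imp _ a b => fun m s => Imp (subst a s) (subst b s)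
  | All _ a => fun m s => All (subst a (up s))
  | Ex _ a => fun m s => Ex (subst a (up s))
  end.

Definition shift n (phi : form S n) : form S n.+1 :=
  subst phi (fun x => Var (lift ord0 x)).

Definition inst n (phi : form S n.+1) (t : term S n) : form S n :=
  subst phi (scons t Var).

End Substitution.

Definition extend S n (G : form S n -> Prop) (phi : form S n) : form S n -> Prop :=
  fun psi => G psi \/ psi = phi.

Definition shift_set S n (G : form S n -> Prop) : form S n.+1 -> Prop :=
  fun psi => exists2 phi, G phi & psi = shift phi.

(* Natural deduction for classical logic. [G |- phi] in scope [n] only uses
   terms with variables among the [n] available ones; hence [prv_dom] is needed
   to express that domains are nonempty. *)
Inductive prv S : forall n, (form S n -> Prop) -> form S n -> Prop :=
| prv_ax n (G : form S n -> Prop) phi : G phi -> prv G phi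
| prv_dom n (G : form S n -> Prop) : prv G (Ex (Eq (Var ord0) (Var ord0)))
| prv_raa n (G : form S n -> Prop) phi : prv (extend G (Neg phi)) Bot -> prv G phi
| prv_andI n (G : form S n -> Prop) a b : prv G a -> prv G b -> prv G (And a b)
| prv_andE1 n (G : form S n -> Prop) a b : prv G (And a b) -> prv G a
| prv_andE2 n (G : form S n -> Prop) a b : prv G (And a b) -> prv G b
| prv_orI1 n (G : form S n -> Prop) a b : prv G a -> prv G (Or a b)
| prv_orI2 n (G : form S n -> Prop) a b : prv G b -> prv G (Or a b)
| prv_orE n (G : form S n -> Prop) a b c :
    prv G (Or a b) -> prv (extend G a) c -> prv (extend G b) c -> prv G c
| prv_impI n (G : form S n -> Prop) a b : prv (extend G a) b -> prv G (Imp a b)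
| prv_impE n (G : form S n -> Prop) a b : prv G (Imp a b) -> prv G a -> prv G b
| prv_allI n (G : form S n -> Prop) phi : prv (shift_set G) phi -> prv G (All phi)
| prv_allE n (G : form S n -> Prop) phi t : prv G (All phi) -> prv G (inst phi t)
| prv_exI n (G : form S n -> Prop) phi t : prv G (inst phi t) -> prv G (Ex phi)
| prv_exE n (G : form S n -> Prop) phi psi :
    prv G (Ex phi) -> prv (extend (shift_set G) phi) (shift psi) -> prv G psi
| prv_eqI n (G : form S n -> Prop) t : prv G (Eq t t)
| prv_eqE n (G : form S n -> Prop) phi t u :
    prv G (Eq t u) -> prv G (inst phi t) -> prv G (inst phi u).

(* The symbols to be translated: identity, the relation symbols, and the
   function symbols viewed as graphs. *)
Inductive psym S := PEq | PRel of rsym S | PFun of fsym S.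
Arguments PEq {S}.

(* In the graph of a function symbol the value comes first, then the
   arguments. *)
Definition par S (P : psym S) : nat :=
  match P with PEq => 2 | PRel R => rar R | PFun f => (far f).+1 end.

(* Objects are sorted into finitely many pieces; an object of piece [i] is a
   [dim i]-tuple satisfying [dom i]. The formula translating a symbol depends on
   the pieces of its arguments; its variables are the concatenation of the
   tuples of the arguments. *)
Record translation (S T : signature) := Translation {
  piece : finType;
  dim : piece -> nat;
  dom : forall i, form T (dim i);
  atom : forall (P : psym S) (p : 'I_(par P) -> piece),
    form T (\sum_(l < par P) dim (p l))
}.

Arguments atom {S T} t P p.

Fixpoint Exs S k m : form S (k + m) -> form S m :=
  match k return form S (k + m) -> form S m with
  | 0 => fun phi => phi
  | k'.+1 => fun phi => Exs (Ex phi : form S (k' + m))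
  end.

Fixpoint Alls S k m : form S (k + m) -> form S m :=
  match k return form S (k + m) -> form S m with
  | 0 => fun phi => phi
  | k'.+1 => fun phi => Alls (All phi : form S (k' + m))
  end.

Section Translate.
Variables (S T : signature) (tau : translation S T).

(* What a source variable becomes: a piece and a tuple of target variables. *)
Definition block (m : nat) := {i : piece tau & 'I_(dim i) -> 'I_m}.

Definition ren_block m m' (r : 'I_m -> 'I_m') (b : block m) : block m' :=
  existT _ (tag b) (fun c => r (tagged b c)).

Definition tr_atom (P : psym S) m (bs : 'I_(par P) -> block m) : form T m :=
  subst (atom tau P (fun l => tag (bs l)))
    (fun v => let u := tagnat.sig v in Var (tagged (bs (tag u)) (tagged u))).

Definition new_block m (i : piece tau) : block (dim i + m) :=
  existT _ i (fun c => lshift m c).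

Definition dom_new m (i : piece tau) : form T (dim i + m) :=
  subst (dom i) (fun c => Var (lshift m c)).

(* Quantification over all objects of all pieces. *)
Definition ex_block m (body : forall i : piece tau, form T (dim i + m)) : form T m :=
  \big[@Or T m/Bot]_(i : piece tau) Exs (And (dom_new m i) (body i)).

Definition all_block m (body : forall i : piece tau, form T (dim i + m)) : form T m :=
  \big[@And T m/Top]_(i : piece tau) Alls (Imp (dom_new m i) (body i)).

Definition ext_env n m (e : 'I_n -> block m) (i : piece tau) :
    'I_n.+1 -> block (dim i + m) :=
  scons (new_block m i) (fun x => ren_block (@rshift (dim i) m) (e x)).

(* Term unwinding: [unwind t e K] says that the value of [t] under [e] satisfies
   [K], introducing an existentially quantified block for the value of every
   non-variable subterm. The continuation receives the enlarged scope [m'], the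
   embedding of the current scope in it, and the block naming the value. *)
Definition unwinder n := forall m, ('I_n -> block m) ->
  (forall m', ('I_m -> 'I_m') -> block m' -> form T m') -> form T m.

Fixpoint unwind_args n k : ('I_k -> unwinder n) -> forall m, ('I_n -> block m) ->
    (forall m', ('I_m -> 'I_m') -> ('I_k -> block m') -> form T m') -> form T m :=
  match k return ('I_k -> unwinder n) -> forall m, ('I_n -> block m) ->
    (forall m', ('I_m -> 'I_m') -> ('I_k -> block m') -> form T m') -> form T m with
  | 0 => fun us m e K => K m id snil
  | k'.+1 => fun us m e K =>
      us ord0 m e (fun m1 r1 b =>
        unwind_args (fun l => us (lift ord0 l)) (fun x => ren_block r1 (e x))
          (fun m2 r2 bs => K m2 (r2 \o r1) (scons (ren_block r2 b) bs)))
  end.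

Fixpoint unwind n (t : term S n) : unwinder n :=
  match t with
  | Var x => fun m e K => K m id (e x)
  | Fun f ts => fun m e K =>
      unwind_args (fun l => unwind (ts l)) e (fun m1 r1 bs =>
        ex_block (fun j : piece tau =>
          And (@tr_atom (PFun f) _
                 (scons (new_block m1 j) (fun l => ren_block (@rshift (dim j) m1) (bs l))))
              (K _ (@rshift (dim j) m1 \o r1) (new_block m1 j))))
  end.

Fixpoint translate n (phi : form S n) : forall m, ('I_n -> block m) -> form T m :=
  match phi in form _ n return forall m, ('I_n -> block m) -> form T m with
  | Bot _ => fun m e => Bot
  | Eq _ t u => fun m e =>
      unwind_args (scons (unwind t) (scons (unwind u) snil)) e
        (fun m' _ bs => @tr_atom PEq m' bs)
  | Rel _ R ts => fun m e =>
      unwind_args (fun l => unwind (ts l)) e (fun m' _ bs => @tr_atom (PRel R) m' bs)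
  | And _ a b => fun m e => And (translate a e) (translate b e)
  | Or _ a b => fun m e => Or (translate a e) (translate b e)
  | Imp _ a b => fun m e => Imp (translate a e) (translate b e)
  | All _ a => fun m e => all_block (fun i => translate a (ext_env e i))
  | Ex _ a => fun m e => ex_block (fun i => translate a (ext_env e i))
  end.

Definition translate_sentence (phi : sentence S) : sentence T :=
  translate phi snil.

End Translate.

(* Since all theorems of [D] are considered, including those of pure logic with
   identity, this entails that the interpreted domain is nonempty, that identity
   is interpreted as a congruence, and that function symbols are interpreted as
   total functions. *)
Definition interprets (T S : signature) (W : theory T) (D : theory S) : Prop :=
  exists tau : translation S T,
    forall phi : sentence S, prv D phi -> prv W (translate_sentence tau phi).

Definition axiomatised_by S (A : sentence S) : theory S := fun phi => phi = A.

Definition interpreter T (U : theory T) S (A : sentence S) (C : sentence T) : Prop :=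
  forall B : sentence T,
    interprets (extend U B) (axiomatised_by A) <-> prv (extend U B) C.

Definition Friedman_reflexive T (U : theory T) : Prop :=
  forall (S : signature) (A : sentence S), exists C : sentence T, interpreter U A C.

(* Main.v *)
(* An interpretation of [Or A B] in [W] also interprets [A] in [W] extended with
   the translation of [A], because it translates every theorem [Imp A phi] of
   [Or A B]. The interpreter property of [C A] therefore makes the translation of
   [A] imply [C A] over [W], likewise for [B], and [W] proves the disjunction of
   the two translations. *)
From mathcomp Require Import all_boot.
Require Import Defs.

Set Implicit Arguments.
Unset Strict Implicit.
Unset Printing Implicit Defensive.

Section Derivations.
Variable S : signature.

Lemma extend_mono n (G G' : form S n -> Prop) phi :
  (forall psi, G psi -> G' psi) ->
  forall psi, extend G phi psi -> extend G' phi psi.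
Proof. by move=> sGG' psi [/sGG'|->]; [left | right]. Qed.

Lemma shift_set_mono n (G G' : form S n -> Prop) :
  (forall psi, G psi -> G' psi) ->
  forall psi, shift_set G psi -> shift_set G' psi.
Proof. by move=> sGG' _ [phi /sGG' G'phi ->]; exists phi. Qed.

Lemma prv_weaken n (G G' : form S n -> Prop) phi :
  prv G phi -> (forall psi, G psi -> G' psi) -> prv G' phi.
Proof.
move=> Gphi; elim: Gphi G' => {n G phi}.
- by move=> n G phi Gphi G' sGG'; exact/prv_ax/sGG'.
- by move=> n G G' _; exact: prv_dom.
- by move=> n G phi _ IH G' sGG'; apply/prv_raa/IH/extend_mono.
- by move=> n G a b _ IHa _ IHb G' sGG'; apply: prv_andI; [exact: IHa | exact: IHb].
- by move=> n G a b _ IH G' sGG'; exact: prv_andE1 (IH _ sGG').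
- by move=> n G a b _ IH G' sGG'; exact: prv_andE2 (IH _ sGG').
- by move=> n G a b _ IH G' sGG'; exact/prv_orI1/IH.
- by move=> n G a b _ IH G' sGG'; exact/prv_orI2/IH.
- move=> n G a b c _ IH _ IHa _ IHb G' sGG'.
  by apply: prv_orE (IH _ sGG') _ _; [apply: IHa | apply: IHb]; exact: extend_mono.
- by move=> n G a b _ IH G' sGG'; apply/prv_impI/IH/extend_mono.
- by move=> n G a b _ IHab _ IHa G' sGG'; exact: prv_impE (IHab _ sGG') (IHa _ sGG').
- by move=> n G phi _ IH G' sGG'; apply/prv_allI/IH/shift_set_mono.
- by move=> n G phi t _ IH G' sGG'; exact/prv_allE/IH.
- by move=> n G phi t _ IH G' sGG'; exact/prv_exI/IH.
- move=> n G phi psi _ IH _ IHphi G' sGG'; apply: prv_exE (IH _ sGG') _.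
  exact/IHphi/extend_mono/shift_set_mono.
- by move=> n G t G' _; exact: prv_eqI.
- by move=> n G phi t u _ IHtu _ IH G' sGG'; exact: prv_eqE (IHtu _ sGG') (IH _ sGG').
Qed.

Lemma prv_hyp n (G : form S n -> Prop) a : prv (extend G a) a.
Proof. by apply: prv_ax; right. Qed.

Lemma prv_extend n (G : form S n -> Prop) a b : prv G b -> prv (extend G a) b.
Proof. by move=> Gb; apply: prv_weaken Gb _; left. Qed.

(** Letting [G'] exceed [G] carries a result over [U] plus one sentence into any larger context that
    derives this sentence. *)
Lemma prv_cut n (G G' : form S n -> Prop) a b :
  (forall psi, G psi -> G' psi) -> prv G' a -> prv (extend G a) b -> prv G' b.
Proof.
move=> sGG' G'a Gab; apply: prv_impE G'a; apply: prv_impI.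
exact/(prv_weaken Gab)/extend_mono.
Qed.

(** With [A] as sole axiom, discharging it leaves a theorem of pure logic, available in any theory
    [G], such as an interpreted [D]. *)
Lemma prv_axiomatised_by (A phi : sentence S) (G : theory S) :
  prv (axiomatised_by A) phi -> prv G (Imp A phi).
Proof. by move=> Aphi; apply/prv_impI/(prv_weaken Aphi) => psi ->; right. Qed.

End Derivations.

Section Interpretations.
Variables (S T : signature).

Lemma interprets_consequence (W : theory T) (A B : sentence S) :
  prv (axiomatised_by A) B ->
  interprets W (axiomatised_by A) -> interprets W (axiomatised_by B).
Proof.
move=> AB [tau tauP]; exists tau => phi Bphi; apply: tauP.
exact: prv_impE (prv_axiomatised_by _ Bphi) AB.
Qed.

Lemma interprets_extend_translation (tau : translation S T) (W W' : theory T)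
    (D : theory S) (A : sentence S) :
  (forall phi, prv D phi -> prv W (translate_sentence tau phi)) ->
  (forall psi, prv W psi -> prv W' psi) ->
  prv W' (translate_sentence tau A) -> interprets W' (axiomatised_by A).
Proof.
move=> tauP sWW' W'A; exists tau => phi Aphi.
(* Translation commutes with [Imp] by computation, so modus ponens applies directly to the
   translation of [Imp A phi]. *)
exact: prv_impE (sWW' _ (tauP _ (prv_axiomatised_by _ Aphi))) W'A.
Qed.

(** Since [U] plus [CA] trivially proves [CA], it interprets [A], hence also the consequence [B];
    the property of [CB] turns this into a proof. *)
Lemma interpreter_mono (U : theory T) (A B : sentence S) (CA CB : sentence T) :
  interpreter U A CA -> interpreter U B CB ->
  prv (axiomatised_by A) B -> prv (extend U CA) CB.
Proof.
move=> hA hB AB; apply/hB/(interprets_consequence AB)/hA.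
exact: prv_hyp.
Qed.

Lemma interpreter_translation (U : theory T) (D : theory S) (A : sentence S)
    (E CA : sentence T) (tau : translation S T) :
  interpreter U A CA ->
  (forall phi, prv D phi -> prv (extend U E) (translate_sentence tau phi)) ->
  prv (extend (extend U E) (translate_sentence tau A)) CA.
Proof.
move=> hA tauP; set At := translate_sentence tau A.
(* The interpreter property speaks of extensions of [U] by a single sentence, so the two hypotheses
   are first merged into a conjunction. *)
have CA_conj : prv (extend U (And E At)) CA.
  apply/hA/(interprets_extend_translation tauP).
    move=> psi; apply: prv_cut; first by left.
    exact: prv_andE1 (prv_hyp _ _).
  exact: prv_andE2 (prv_hyp _ _).
apply: prv_cut CA_conj; first by left; left.
by apply: prv_andI; [exact/prv_extend/prv_hyp | exact: prv_hyp].
Qed.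

End Interpretations.

Theorem theorem2p5 (T : signature) (U : theory T) (hU : Friedman_reflexive U)
  (C : forall S : signature, sentence S -> sentence T)
  (hC : forall (S : signature) (A : sentence S), interpreter U A (C S A)) :
  (forall S : signature, prv U (Neg (C S Bot))) /\
  (forall (S : signature) (A B : sentence S),
     prv U (Iff (C S (Or A B)) (Or (C S A) (C S B)))).
Proof.
split=> [S | S A B].
  have [tau tauP] := (hC S Bot (C S Bot)).2 (prv_hyp _ _).
  (* [Bot] translates to [Bot], so [U] plus [C S Bot] is inconsistent. *)
  exact: prv_impI (tauP Bot (prv_ax erefl)).
apply: prv_andI; apply: prv_impI.
  have [tau tauP] := (hC S (Or A B) (C S (Or A B))).2 (prv_hyp _ _).
  have AorB := tauP (Or A B) (prv_ax erefl).
  (* The translation of [Or A B] unfolds to the disjunction of the translations, which permits the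
     case split. *)
  apply: prv_orE AorB _ _.
    exact/prv_orI1/(interpreter_translation (hC S A) tauP).
  exact/prv_orI2/(interpreter_translation (hC S B) tauP).
(* Conversely, each disjunct entails [Or A B], and interpreters are monotone under entailment. *)
apply: prv_orE (prv_hyp _ _) _ _.
  apply: prv_cut (prv_hyp _ _) (interpreter_mono (hC S A) (hC S (Or A B)) _).
    by left; left.
  exact/prv_orI1/prv_ax.
apply: prv_cut (prv_hyp _ _) (interpreter_mono (hC S B) (hC S (Or A B)) _).
  by left; left.
exact/prv_orI2/prv_ax.
Qed.
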